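(* Let $p \geq 5$ be a prime and let $a_1,a_2,a_3 \in \mathbb{F}_p$ with $s := 3+a_1+a_2+a_3 \neq 0$ in $\mathbb{F}_p$. Let $S \subseteq \mathbb{F}_p^3$ be the set of solutions $(x_1,x_2,x_3)$ of \[ x_1^2+x_2^2+x_3^2+a_1x_2x_3+a_2x_1x_3+a_3x_1x_2 = s\,x_1x_2x_3, \] and for $i \in \{1,2,3\}$ (indices taken modulo $3$) let $m_i : S \to S$ be the map replacing $x_i$ by $-x_i + s x_{i-1}x_{i+1} - a_{i+1}x_{i-1} - a_{i-1}x_{i+1}$ and leaving the other two coordinates unchanged. Consider the orbits of the group generated by $m_1,m_2,m_3$ acting on $S$. \begin{enumerate} \item If $a_i^2 \neq 4$ for all $i=1,2,3$, then every orbit other than the orbit $\{(0,0,0)\}$ has size divisible by $p$. \item If there is an index $i$ with $a_i^2 = 4$ and $2a_{i-1} = a_{i+1}a_i$ (indices modulo $3$), then every orbit other than $\{(0,0,0)\}$ has size divisible by $p$. \end{enumerate}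
   Context: Each $m_i$ is an involution of $S$ (it exchanges the two roots of the defining equation viewed as a quadratic in $x_i$). The point $(0,0,0)$ always lies in $S$ and is fixed by all moves. *)

(* Defs.v *)
From HB Require Import structures.
From mathcomp Require Import all_boot all_order all_algebra.
Set Implicit Arguments. Unset Strict Implicit. Unset Printing Implicit Defensive.
Import GRing.Theory.
Local Open Scope ring_scope.

Definition pt (p : nat) := ('F_p * 'F_p * 'F_p)%type.

Definition sMk (p : nat) (a1 a2 a3 : 'F_p) : 'F_p := 3%:R + a1 + a2 + a3.

Definition onS (p : nat) (a1 a2 a3 : 'F_p) (x : pt p) : bool :=
  let: (x1, x2, x3) := x in
  x1 ^+ 2 + x2 ^+ 2 + x3 ^+ 2 + a1 * x2 * x3 + a2 * x1 * x3 + a3 * x1 * x2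
  == sMk a1 a2 a3 * x1 * x2 * x3.

Definition move1 (p : nat) (a1 a2 a3 : 'F_p) (x : pt p) : pt p :=
  let: (x1, x2, x3) := x in
  (- x1 + sMk a1 a2 a3 * x3 * x2 - a2 * x3 - a3 * x2, x2, x3).
Definition move2 (p : nat) (a1 a2 a3 : 'F_p) (x : pt p) : pt p :=
  let: (x1, x2, x3) := x in
  (x1, - x2 + sMk a1 a2 a3 * x1 * x3 - a3 * x1 - a1 * x3, x3).
Definition move3 (p : nat) (a1 a2 a3 : 'F_p) (x : pt p) : pt p :=
  let: (x1, x2, x3) := x in
  (x1, x2, - x3 + sMk a1 a2 a3 * x2 * x1 - a1 * x2 - a2 * x1).

Definition step (p : nat) (a1 a2 a3 : 'F_p) : rel (pt p) :=
  fun x y => [&& onS a1 a2 a3 x, onS a1 a2 a3 y &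
    [|| y == move1 a1 a2 a3 x, y == move2 a1 a2 a3 x, y == move3 a1 a2 a3 x,
        x == move1 a1 a2 a3 y, x == move2 a1 a2 a3 y | x == move3 a1 a2 a3 y]].

Definition orbitS (p : nat) (a1 a2 a3 : 'F_p) (x : pt p) : {set pt p} :=
  [set y | connect (step a1 a2 a3) x y].

(* Main.v *)
(** Write 1/0 = 0.  Since m_1 preserves x_2 and x_3, summing x_1 / (x_2 x_3)
    over an orbit O in two ways gives
    2 sum x_1 / (x_2 x_3) = sum_{x_2 x_3 != 0} (s - a_2 / x_2 - a_3 / x_3).
    Add the three cyclic versions: by the equation of S, the left-hand summand
    becomes 2 (s - a_1 / x_1 - a_2 / x_2 - a_3 / x_3) where no coordinate
    vanishes.  Hence s |O| equals the sum of a_2 / x_2 + a_3 / x_3 over the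
    points of O with x_1 = 0, plus the two cyclic analogues.  A nonzero point
    of S has at most one zero coordinate, and m_2, m_3 preserve the points with
    x_1 = 0; with P and Q the sums of 1 / x_2 and 1 / x_3 over them, these
    involutions force 2 P + a_1 Q = 0 and 2 Q + a_1 P = 0, so that
    a_2 P + a_3 Q = 0 if a_1 ^ 2 != 4 or 2 a_3 = a_2 a_1.  If the hypothesis of
    part 2 holds for one index, this alternative holds for every index. *)
Require Import Defs.
From HB Require Import structures.
From mathcomp Require Import all_boot all_order all_algebra.
From mathcomp Require Import ring.
Import GRing.Theory.
Local Open Scope ring_scope.

Lemma sum_involution {T : finType} {V : zmodType} {O : {set T}} {m : T -> T}
    (u : T -> V) :
  involutive m -> {in O, forall t, m t \in O} ->
  \sum_(t in O) (u t - u (m t)) = 0.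
Proof.
move=> mK mO; rewrite sumrB; apply/eqP; rewrite subr_eq0; apply/eqP.
rewrite (reindex_inj (inv_inj mK)) /=; apply: eq_bigl => t.
by apply/idP/idP => /mO //; rewrite mK.
Qed.

(** The weight [y / z ^ 2] is summed over [O] in two ways. Its change under [m] is 2 y / z ^ 2 + a /
    z, which the quadratic relation turns into - (2 / y + a / z). *)
Lemma sum_inv_involution {T : finType} {F : fieldType} {O : {set T}}
    {m : T -> T} {y z : T -> F} {a : F} :
  involutive m -> {in O, forall t, m t \in O} ->
  {in O, forall t, [/\ y t != 0, z t != 0 &
    y t ^+ 2 + z t ^+ 2 + a * y t * z t = 0]} ->
  {in O, forall t, y (m t) = - y t - a * z t} -> z \o m =1 z ->
  2%:R * (\sum_(t in O) (y t)^-1) + a * (\sum_(t in O) (z t)^-1) = 0.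
Proof.
move=> mK mO yzO ym zm.
apply: oppr_inj; rewrite oppr0.
rewrite -[RHS](sum_involution (fun t => y t / z t ^+ 2) mK mO).
rewrite !mulr_sumr -big_split -sumrN; apply: eq_bigr => t tO /=.
have [y0 z0 yz] := yzO t tO; rewrite ym // (zm t : z (m t) = z t).
have key : y t / z t ^+ 2 = - a / z t - (y t)^-1.
  apply: (mulfI (mulf_neq0 y0 (expf_neq0 2 z0))); apply/eqP.
  rewrite -subr_eq0; apply/eqP.
  transitivity (y t ^+ 2 + z t ^+ 2 + a * y t * z t); last by [].
  by field; rewrite y0.
have -> : (- y t - a * z t) / z t ^+ 2 = - (y t / z t ^+ 2) - a / z t.
  by field.
by rewrite key; ring.
Qed.

Lemma sum_zero_coordinate {T : finType} {F : fieldType} {O : {set T}}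
    {m n : T -> T} {y z : T -> F} {a b c : F} :
  2%:R != 0 :> F -> (a ^+ 2 != 4%:R \/ 2%:R * c = b * a) ->
  involutive m -> {in O, forall t, m t \in O} ->
  involutive n -> {in O, forall t, n t \in O} ->
  {in O, forall t, [/\ y t != 0, z t != 0 &
    y t ^+ 2 + z t ^+ 2 + a * y t * z t = 0]} ->
  {in O, forall t, y (m t) = - y t - a * z t} -> z \o m =1 z ->
  {in O, forall t, z (n t) = - z t - a * y t} -> y \o n =1 y ->
  \sum_(t in O) (b / y t + c / z t) = 0.
Proof.
move=> nz2 habc mK mO nK nO yzO ym zm zn yn.
have E1 := sum_inv_involution mK mO yzO ym zm.
have zyO : {in O, forall t, [/\ z t != 0, y t != 0 &
    z t ^+ 2 + y t ^+ 2 + a * z t * y t = 0]}.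
  by move=> t /yzO[-> -> E]; split=> //; rewrite -[RHS]E; ring.
have E2 := sum_inv_involution nK nO zyO zn yn.
rewrite big_split /= -!mulr_sumr.
move: (\sum_(t in O) _) (\sum_(t in O) _) E1 E2 => P Q E1 E2.
(* If 2 c = b a, twice the goal is [b] times [E1]. Otherwise [E1] and [E2] form a linear system in
   [P] and [Q] of determinant 4 - a ^ 2, hence P = Q = 0. *)
case: habc => [a4 | cba]; last first.
  apply: (mulfI nz2); rewrite mulr0 mulrDr !mulrA cba.
  by rewrite -[RHS](mulr0 b) -E1; ring.
have det0 : a ^+ 2 - 4%:R != 0 by rewrite subr_eq0.
have -> : P = 0.
  by apply: (mulfI det0); transitivity (a * (2%:R * Q + a * P)
    - 2%:R * (2%:R * P + a * Q)); [ring | rewrite E1 E2; ring].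
have -> : Q = 0.
  by apply: (mulfI det0); transitivity (a * (2%:R * P + a * Q)
    - 2%:R * (2%:R * Q + a * P)); [ring | rewrite E1 E2; ring].
by rewrite !mulr0 addr0.
Qed.

Lemma move1K (p : nat) (a1 a2 a3 : 'F_p) : involutive (move1 a1 a2 a3).
Proof. by move=> [[x1 x2] x3] /=; congr (_, _, _); ring. Qed.

Lemma move2K (p : nat) (a1 a2 a3 : 'F_p) : involutive (move2 a1 a2 a3).
Proof. by move=> [[x1 x2] x3] /=; congr (_, _, _); ring. Qed.

Lemma move3K (p : nat) (a1 a2 a3 : 'F_p) : involutive (move3 a1 a2 a3).
Proof. by move=> [[x1 x2] x3] /=; congr (_, _, _); ring. Qed.

Lemma onS_move1 (p : nat) (a1 a2 a3 : 'F_p) (t : pt p) :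
  onS a1 a2 a3 t -> onS a1 a2 a3 (move1 a1 a2 a3 t).
Proof.
move: t => [[x1 x2] x3] /= /eqP E; rewrite -subr_eq0; apply/eqP.
by rewrite -(subrr (sMk a1 a2 a3 * x1 * x2 * x3)) -{1}E; ring.
Qed.

Lemma onS_move2 (p : nat) (a1 a2 a3 : 'F_p) (t : pt p) :
  onS a1 a2 a3 t -> onS a1 a2 a3 (move2 a1 a2 a3 t).
Proof.
move: t => [[x1 x2] x3] /= /eqP E; rewrite -subr_eq0; apply/eqP.
by rewrite -(subrr (sMk a1 a2 a3 * x1 * x2 * x3)) -{1}E; ring.
Qed.

Lemma onS_move3 (p : nat) (a1 a2 a3 : 'F_p) (t : pt p) :
  onS a1 a2 a3 t -> onS a1 a2 a3 (move3 a1 a2 a3 t).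
Proof.
move: t => [[x1 x2] x3] /= /eqP E; rewrite -subr_eq0; apply/eqP.
by rewrite -(subrr (sMk a1 a2 a3 * x1 * x2 * x3)) -{1}E; ring.
Qed.

(** Every move is an involution fixing the origin, so no step enters or leaves it. *)
Lemma step_eq0 (p : nat) (a1 a2 a3 : 'F_p) (x y : pt p) :
  step a1 a2 a3 x y -> (x == (0, 0, 0)) = (y == (0, 0, 0)).
Proof.
have m1_0 : move1 a1 a2 a3 (0, 0, 0) = (0, 0, 0).
  by congr (_, _, _); ring.
have m2_0 : move2 a1 a2 a3 (0, 0, 0) = (0, 0, 0).
  by congr (_, _, _); ring.
have m3_0 : move3 a1 a2 a3 (0, 0, 0) = (0, 0, 0).
  by congr (_, _, _); ring.
move=> /and3P[_ _].
by case/or4P=> [|||/or3P[]] /eqP->; rewrite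
  ?(inv_eq (move1K _ a1 a2 a3)) ?(inv_eq (move2K _ a1 a2 a3))
  ?(inv_eq (move3K _ a1 a2 a3)) ?m1_0 ?m2_0 ?m3_0.
Qed.

Lemma orbitS_neq0 (p : nat) (a1 a2 a3 : 'F_p) (x : pt p) :
  onS a1 a2 a3 x -> x != (0, 0, 0) ->
  {in orbitS a1 a2 a3 x, forall t, onS a1 a2 a3 t /\ t != (0, 0, 0)}.
Proof.
move=> Sx x0 t; rewrite inE => xt; split.
  have := closed_connect (a := [pred z | onS a1 a2 a3 z]) _ xt.
  by rewrite !inE => <- // y z /and3P[Sy Sz _]; rewrite !inE Sy Sz.
have := closed_connect (a := [pred z : pt p | z != (0, 0, 0)]) _ xt.
by rewrite !inE => <- // y z /step_eq0; rewrite !inE => ->.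
Qed.

Lemma step_orbitS (p : nat) (a1 a2 a3 : 'F_p) (x t t' : pt p) :
  t \in orbitS a1 a2 a3 x -> step a1 a2 a3 t t' -> t' \in orbitS a1 a2 a3 x.
Proof. by rewrite !inE => xt /connect1; apply: connect_trans. Qed.

(** When two coordinates vanish, the equation says that the square of the third is 0. *)
Lemma onS_coordinates_neq0 {p : nat} {a1 a2 a3 : 'F_p} {t : pt p} :
  onS a1 a2 a3 t -> t != (0, 0, 0) ->
  [/\ (t.1.1 != 0) || (t.1.2 != 0), (t.1.2 != 0) || (t.2 != 0) &
      (t.2 != 0) || (t.1.1 != 0)].
Proof.
case: t => [[x1 x2] x3] /= /eqP E t0.
split; rewrite -negb_and; apply: contra t0 => /andP[/eqP u0 /eqP v0];
  move: E; rewrite u0 v0 ?(mul0r, mulr0, addr0, add0r, expr0n) /= => /eqP;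
  by rewrite expf_eq0 /= => /eqP->.
Qed.

(* As 1/0 = 0, each weight x_i / (x_(i-1) x_(i+1)) is supported on points where
   the other two coordinates do not vanish. *)
Lemma weight_identity {p : nat} {a1 a2 a3 : 'F_p} {t : pt p} :
  let u1 (x : pt p) := x.1.1 / (x.1.2 * x.2) in
  let u2 (x : pt p) := x.1.2 / (x.2 * x.1.1) in
  let u3 (x : pt p) := x.2 / (x.1.1 * x.1.2) in
  onS a1 a2 a3 t -> t != (0, 0, 0) ->
  (u1 t - u1 (move1 a1 a2 a3 t)) + (u2 t - u2 (move2 a1 a2 a3 t)) +
    (u3 t - u3 (move3 a1 a2 a3 t)) =
  - sMk a1 a2 a3 + (if t.1.1 == 0 then a2 / t.1.2 + a3 / t.2 else 0)
    + (if t.1.2 == 0 then a3 / t.2 + a1 / t.1.1 else 0)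
    + (if t.2 == 0 then a1 / t.1.1 + a2 / t.1.2 else 0).
Proof.
case: t => [[x1 x2] x3] u1 u2 u3 St t0.
have [] := onS_coordinates_neq0 St t0; rewrite {}/u1 {}/u2 {}/u3 /=.
move: St => /= /eqP; set s := sMk a1 a2 a3 => E.
have [->|x10] := eqVneq x1 0; have [->|x20] := eqVneq x2 0;
  have [->|x30] := eqVneq x3 0 => // _ _ _;
  rewrite ?(mul0r, mulr0, invr0, subr0, add0r, addr0).
(* With exactly one zero coordinate, only the weight having it as numerator can change; its new
   value supplies both - s and the correction term. *)
- by field; rewrite ?x20 ?x30.
- by field; rewrite ?x10 ?x30.
- by field; rewrite ?x10 ?x20.
apply/eqP; rewrite -subr_eq0 opprK; apply/eqP.
(* Where no coordinate vanishes, the two sides differ by twice the equation of S divided by x1 x2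
   x3. *)
transitivity (2%:R * (x1 ^+ 2 + x2 ^+ 2 + x3 ^+ 2 + a1 * x2 * x3 +
  a2 * x1 * x3 + a3 * x1 * x2 - s * x1 * x2 * x3) / (x1 * x2 * x3)).
  by field; rewrite x10 x20 x30.
by rewrite E subrr mulr0 mul0r.
Qed.

Lemma card_invariant_set (p : nat) (a1 a2 a3 : 'F_p) (O : {set pt p}) :
  2%:R != 0 :> 'F_p ->
  [/\ a1 ^+ 2 != 4%:R \/ 2%:R * a3 = a2 * a1,
      a2 ^+ 2 != 4%:R \/ 2%:R * a1 = a3 * a2 &
      a3 ^+ 2 != 4%:R \/ 2%:R * a2 = a1 * a3] ->
  {in O, forall t, onS a1 a2 a3 t /\ t != (0, 0, 0)} ->
  {in O, forall t, move1 a1 a2 a3 t \in O} ->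
  {in O, forall t, move2 a1 a2 a3 t \in O} ->
  {in O, forall t, move3 a1 a2 a3 t \in O} ->
  sMk a1 a2 a3 * #|O|%:R = 0.
Proof.
move=> nz2 [h1 h2 h3] SO m1O m2O m3O.
(* On x1 = 0 the equation becomes the binary form x2 ^ 2 + x3 ^ 2 + a1 x2 x3 = 0, and [move2],
   [move3] become linear in (x2, x3). *)
have Z1 : \sum_(t in [set t in O | t.1.1 == 0]) (a2 / t.1.2 + a3 / t.2) = 0.
  apply: (sum_zero_coordinate nz2 h1 (move2K p a1 a2 a3) _
    (move3K p a1 a2 a3)).
  - by move=> [[x1 x2] x3]; rewrite !inE => /andP[/m2O-> /= ->].
  - by move=> [[x1 x2] x3]; rewrite !inE => /andP[/m3O-> /= ->].
  - move=> [[x1 x2] x3]; rewrite !inE => /andP[/SO[Sx x0] /= /eqP Ex1].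
    have [] := onS_coordinates_neq0 Sx x0; move: Sx => /= /eqP.
    rewrite Ex1 eqxx ?orbF ?(mul0r, mulr0, add0r, addr0, expr0n) /= => E *.
    by split=> //; rewrite -[RHS]E; ring.
  - by move=> [[x1 x2] x3]; rewrite !inE => /andP[_ /= /eqP->]; ring.
  - by move=> [[x1 x2] x3].
  - by move=> [[x1 x2] x3]; rewrite !inE => /andP[_ /= /eqP->]; ring.
  - by move=> [[x1 x2] x3].
have Z2 : \sum_(t in [set t in O | t.1.2 == 0]) (a3 / t.2 + a1 / t.1.1) = 0.
  apply: (sum_zero_coordinate nz2 h2 (move3K p a1 a2 a3) _
    (move1K p a1 a2 a3)).
  - by move=> [[x1 x2] x3]; rewrite !inE => /andP[/m3O-> /= ->].
  - by move=> [[x1 x2] x3]; rewrite !inE => /andP[/m1O-> /= ->].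
  - move=> [[x1 x2] x3]; rewrite !inE => /andP[/SO[Sx x0] /= /eqP Ex2].
    have [] := onS_coordinates_neq0 Sx x0; move: Sx => /= /eqP.
    rewrite Ex2 eqxx ?orbF ?(mul0r, mulr0, add0r, addr0, expr0n) /= => E *.
    by split=> //; rewrite -[RHS]E; ring.
  - by move=> [[x1 x2] x3]; rewrite !inE => /andP[_ /= /eqP->]; ring.
  - by move=> [[x1 x2] x3].
  - by move=> [[x1 x2] x3]; rewrite !inE => /andP[_ /= /eqP->]; ring.
  - by move=> [[x1 x2] x3].
have Z3 : \sum_(t in [set t in O | t.2 == 0]) (a1 / t.1.1 + a2 / t.1.2) = 0.
  apply: (sum_zero_coordinate nz2 h3 (move1K p a1 a2 a3) _
    (move2K p a1 a2 a3)).
  - by move=> [[x1 x2] x3]; rewrite !inE => /andP[/m1O-> /= ->].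
  - by move=> [[x1 x2] x3]; rewrite !inE => /andP[/m2O-> /= ->].
  - move=> [[x1 x2] x3]; rewrite !inE => /andP[/SO[Sx x0] /= /eqP Ex3].
    have [] := onS_coordinates_neq0 Sx x0; move: Sx => /= /eqP.
    rewrite Ex3 eqxx ?orbF ?(mul0r, mulr0, add0r, addr0, expr0n) /= => E *.
    by split=> //; rewrite -[RHS]E; ring.
  - by move=> [[x1 x2] x3]; rewrite !inE => /andP[_ /= /eqP->]; ring.
  - by move=> [[x1 x2] x3].
  - by move=> [[x1 x2] x3]; rewrite !inE => /andP[_ /= /eqP->]; ring.
  - by move=> [[x1 x2] x3].
have U1 := sum_involution (fun x : pt p => x.1.1 / (x.1.2 * x.2))
  (move1K p a1 a2 a3) m1O.
have U2 := sum_involution (fun x : pt p => x.1.2 / (x.2 * x.1.1))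
  (move2K p a1 a2 a3) m2O.
have U3 := sum_involution (fun x : pt p => x.2 / (x.1.1 * x.1.2))
  (move3K p a1 a2 a3) m3O.
have sumO (P : pred (pt p)) f : \sum_(t in [set t in O | P t]) f t =
    \sum_(t in O) (if P t then f t else 0) :> 'F_p.
  by rewrite -big_mkcondr; apply: eq_bigl => t; rewrite inE.
(* The three vanishing sums are added under one summation sign, so that [weight_identity] applies
   pointwise; after [Z1], [Z2], [Z3] only the constant - s remains. *)
have := congr2 +%R (congr2 +%R U1 U2) U3; rewrite /= -!big_split !addr0.
rewrite (eq_bigr _ (fun t tO =>
  weight_identity (proj1 (SO t tO)) (proj2 (SO t tO)))) /=.
rewrite !big_split /= -!sumO Z1 Z2 Z3 !addr0 sumr_const.
by move/eqP; rewrite mulNrn oppr_eq0 mulr_natr => /eqP.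
Qed.

Theorem theorem1p1 (p : nat) (a1 a2 a3 : 'F_p) :
  prime p -> (5 <= p)%N -> sMk a1 a2 a3 != 0 ->
  ((a1 ^+ 2 != 4%:R /\ a2 ^+ 2 != 4%:R /\ a3 ^+ 2 != 4%:R) \/
   ((a1 ^+ 2 = 4%:R /\ 2%:R * a3 = a2 * a1) \/
    (a2 ^+ 2 = 4%:R /\ 2%:R * a1 = a3 * a2) \/
    (a3 ^+ 2 = 4%:R /\ 2%:R * a2 = a1 * a3))) ->
  forall x : pt p, onS a1 a2 a3 x -> x != (0, 0, 0) ->
    (p %| #|orbitS a1 a2 a3 x|)%N.
Proof.
move=> p_pr p_ge5 s_neq0 ha x Sx x0.
have pF := pchar_Fp p_pr.
have nz2 : 2%:R != 0 :> 'F_p.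
  by rewrite -(dvdn_pcharf pF) gtnNdvd // (leq_trans _ p_ge5).
suff : sMk a1 a2 a3 * #|orbitS a1 a2 a3 x|%:R = 0.
  by move/eqP; rewrite mulf_eq0 (negPf s_neq0) /= -(dvdn_pcharf pF).
have SO := orbitS_neq0 p a1 a2 a3 x Sx x0.
apply: card_invariant_set => // [|t tO|t tO|t tO].
(* If b ^ 2 = 4, then 2 (c b) = a b ^ 2 = 4 a, and 2 cancels. *)
- have sqr_neq4 (a b c : 'F_p) : a ^+ 2 = 4%:R -> 2%:R * c = b * a ->
      b ^+ 2 != 4%:R \/ 2%:R * a = c * b.
    move=> a4 cba; have [b4|] := eqVneq (b ^+ 2) 4%:R; [right | by left].
    apply: (mulfI nz2); rewrite [RHS]mulrA cba.
    by transitivity (a * b ^+ 2); [rewrite b4 | ]; ring.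
  have cyc (a b c : 'F_p) : a ^+ 2 = 4%:R -> 2%:R * c = b * a ->
      [/\ a ^+ 2 != 4%:R \/ 2%:R * c = b * a,
          b ^+ 2 != 4%:R \/ 2%:R * a = c * b &
          c ^+ 2 != 4%:R \/ 2%:R * b = a * c].
    move=> a4 cba; have b4 := sqr_neq4 _ _ _ a4 cba; split=> //; first by right.
    (* Here 2 (a c) = b a ^ 2 = 4 b. *)
    have [c4|] := eqVneq (c ^+ 2) 4%:R; [right | by left].
    apply: (mulfI nz2); rewrite [RHS]mulrCA cba.
    by transitivity (b * a ^+ 2); [rewrite a4 | ]; ring.
  case: ha => [[h1 [h2 h3]] | [[a4 h] | [[a4 h] | [a4 h]]]].
  + by split; left.
  + exact: cyc.
  (* For the other two indices, [cyc] returns the same three conditions in rotated order. *)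
  + by have [] := cyc _ _ _ a4 h.
  + by have [] := cyc _ _ _ a4 h.
- have [St _] := SO t tO; apply: step_orbitS tO _.
  by rewrite /step St onS_move1 // eqxx.
- have [St _] := SO t tO; apply: step_orbitS tO _.
  by rewrite /step St onS_move2 // eqxx !orbT.
- have [St _] := SO t tO; apply: step_orbitS tO _.
  by rewrite /step St onS_move3 // eqxx !orbT.
Qed.
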